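(* Let $G$ be a connected vertex-transitive graph and $z\in V(G)$. If $\theta$ is a (real) root of $\mu(G\setminus z,x)$, then $G$ is $\theta$-super positive.
   Context: All graphs are finite and simple. For a graph $G$ on $n$ vertices, $p(G,r)$ is the number of $r$-matchings in $G$ ($p(G,0)=1$) and $\mu(G,x)=\sum_{r=0}^{\lfloor n/2\rfloor}(-1)^r p(G,r)x^{n-2r}$ is its matching polynomial. $G\setminus v$ denotes deletion of vertex $v$ and incident edges. $G$ is $\theta$-super positive if $\mu(G,\theta)\neq 0$ and $\mu(G\setminus v,\theta)=0$ for every $v\in V(G)$. *)

(* Defs.v *)
From HB Require Import structures.
From mathcomp Require Import all_boot all_order all_algebra.
From mathcomp Require Import perm reals.

Set Implicit Arguments.
Unset Strict Implicit.
Unset Printing Implicit Defensive.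

Import Order.TTheory GRing.Theory Num.Theory.

Local Open Scope ring_scope.

Record sgraph := SGraph {
  vertex :> finType;
  adj : rel vertex;
  adj_sym : symmetric adj;
  adj_irrefl : irreflexive adj
}.

Section DeleteVertex.
Variables (G : sgraph) (v : G).

Definition del_adj : rel {x : G | x != v} :=
  fun x y => adj (val x) (val y).

Lemma del_adj_sym : symmetric del_adj.
Proof. by move=> x y; apply: adj_sym. Qed.

Lemma del_adj_irrefl : irreflexive del_adj.
Proof. by move=> x; apply: adj_irrefl. Qed.

Definition del_vertex : sgraph := SGraph del_adj_sym del_adj_irrefl.

End DeleteVertex.

Definition edges (G : sgraph) : {set {set G}} :=
  [set E : {set G} | [exists x : G, exists y : G, adj x y && (E == [set x; y])]].

Definition is_matching (G : sgraph) (M : {set {set G}}) : bool :=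
  (M \subset edges G) && trivIset M.

Definition num_matchings (G : sgraph) (r : nat) : nat :=
  #|[set M : {set {set G}} | is_matching M && (#|M| == r)]|.

(* Since r ranges up to #|G|./2, the truncated subtraction is exact. *)
Definition matching_poly (R : nzRingType) (G : sgraph) : {poly R} :=
  \sum_(r < (#|G|./2).+1)
    ((-1) ^+ r * (num_matchings G r)%:R) *: 'X^(#|G| - r.*2).

Definition super_positive (R : nzRingType) (theta : R) (G : sgraph) : Prop :=
  (matching_poly R G).[theta] != 0 /\
  forall v : G, (matching_poly R (del_vertex v)).[theta] = 0.

Definition connected_graph (G : sgraph) : Prop :=
  (0 < #|G|)%N /\ forall x y : G, connect (@adj G) x y.

Definition graph_automorphism (G : sgraph) (s : {perm G}) : Prop :=
  forall x y : G, adj (s x) (s y) = adj x y.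

Definition vertex_transitive (G : sgraph) : Prop :=
  forall x y : G, exists2 s : {perm G}, graph_automorphism s & s x = y.

(* Main.v *)
(* If theta is a root of both mu(G) and mu(G \ z), vertex transitivity and
   mu(G)' = sum_v mu(G \ v) give theta the same multiplicity m - 1 >= 1 in every
   mu(G \ v), where m is its multiplicity in mu(G).  Call u, v parallel when
   (x - theta)^(m-1) divides mu(G \ u \ v).  The Heilmann-Lieb inequality makes
   adjacent vertices parallel; its version with arbitrary real vertex weights
   makes parallelism transitive (as for parallel elements of the matroid
   carried by the support of a real stable polynomial).  By connectedness all
   pairs are parallel, so (x - theta)^(m-1) divides
   mu(G \ z)' = sum_v mu(G \ z \ v), and theta has multiplicity m in
   mu(G \ z), a contradiction. *)
Require Import Defs.
From HB Require Import structures.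
From mathcomp Require Import all_boot all_order all_algebra.
From mathcomp Require Import perm reals.
From mathcomp Require Import ring polyrcf.

Set Implicit Arguments.
Unset Strict Implicit.
Unset Printing Implicit Defensive.

Import Order.TTheory GRing.Theory Num.Theory.

Local Open Scope ring_scope.

(** * Edges and matchings *)

Lemma edgeP (G : sgraph) (E : {set G}) :
  reflect (exists x y, adj x y /\ E = [set x; y]) (E \in edges G).
Proof.
rewrite inE; apply: (iffP existsP).
  by case=> x /existsP[y /andP[xy /eqP ->]]; exists x, y.
by case=> x [y [xy ->]]; exists x; apply/existsP; exists y; rewrite xy eqxx.
Qed.

Lemma adj_neq (G : sgraph) (x y : G) : adj x y -> x != y.
Proof. by apply: contraTneq => ->; rewrite adj_irrefl. Qed.

Lemma matching_cover_card (G : sgraph) (M : {set {set G}}) :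
  is_matching M -> #|cover M| = (#|M|).*2.
Proof.
case/andP=> /subsetP edM /eqP <-; rewrite -muln2 -sum_nat_const.
by apply: eq_bigr => E /edM/edgeP[x [y [/adj_neq nxy ->]]]; rewrite cards2 nxy.
Qed.

Lemma matching_edge_uniq (G : sgraph) (M : {set {set G}}) (u k l : G) :
  is_matching M -> [set u; k] \in M -> [set u; l] \in M -> k = l.
Proof.
case/andP=> /subsetP edM /trivIsetP tM ukM ulM.
have /eqP eqE : [set u; k] == [set u; l].
  apply: contraT => /(tM _ _ ukM ulM)/pred0P/(_ u).
  by rewrite /= !inE eqxx.
have /edgeP[a [b [/adj_neq ab Eab]]] := edM _ ukM.
have uk : u != k.
  have := cards2 a b; rewrite -Eab ab cards2; by case: eqP.
have : k \in [set u; l] by rewrite -eqE !inE eqxx orbT.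
by rewrite !inE eq_sym (negbTE uk) => /eqP.
Qed.

Lemma matching_coverP (G : sgraph) (M : {set {set G}}) (u : G) :
  is_matching M ->
  reflect (exists2 k, adj u k & [set u; k] \in M) (u \in cover M).
Proof.
case/andP=> /subsetP edM _; apply: (iffP bigcupP) => [[E EM uE]|[k _ ukM]].
  have /edgeP[a [b [ab Eab]]] := edM _ EM.
  move: uE; rewrite Eab !inE => /orP[]/eqP->; first by exists b; rewrite -?Eab.
  by exists a; rewrite ?(adj_sym b) // setUC -Eab.
by exists [set u; k]; rewrite // !inE eqxx.
Qed.

Lemma matchingD1 (G : sgraph) (M : {set {set G}}) (E : {set G}) :
  is_matching M -> is_matching (M :\ E).
Proof.
case/andP=> edM tM; apply/andP; split; last exact: trivIsetD.
exact: subset_trans (subD1set _ _) edM.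
Qed.

Lemma matchingU1 (G : sgraph) (M : {set {set G}}) (u k : G) :
    adj u k -> is_matching M -> [disjoint [set u; k] & cover M] ->
  is_matching ([set u; k] |: M) && ([set u; k] \notin M).
Proof.
move=> uk /andP[edM tM] dis.
have disB : {in M, forall B : {set G}, [disjoint [set u; k] & B]}.
  by move=> B BM; apply: disjointWr dis; apply: bigcup_sup.
have n0 : set0 \notin M.
  apply/negP => /(subsetP edM)/edgeP[x [y [_ /setP/(_ x)]]].
  by rewrite !inE eqxx.
have [tU ->] := trivIsetU1 disB tM n0; rewrite andbT /is_matching tU andbT.
by rewrite subUset edM andbT sub1set; apply/edgeP; exists u, k.
Qed.

(** * Weighted matching polynomials of induced subgraphs *)

(* The weighted matching polynomial of the subgraph induced by S. *)
Definition wmatching (A : comNzRingType) (G : sgraph) (x : G -> A)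
    (S : {set G}) : A :=
  \sum_(M : {set {set G}} | is_matching M && (cover M \subset S))
    (-1) ^+ #|M| * \prod_(v in S :\: cover M) x v.

Lemma wmatching0 (A : comNzRingType) (G : sgraph) (x : G -> A) :
  wmatching x set0 = 1.
Proof.
rewrite /wmatching (big_pred1 set0) => [|M /=].
  by rewrite cards0 expr0 mul1r set0D big_set0.
apply/andP/eqP => [[mM]|->].
  by rewrite subset0 -cards_eq0 (matching_cover_card mM) double_eq0 cards_eq0 => /eqP.
rewrite /is_matching sub0set /trivIset /cover !big_set0 cards0 eqxx.
by rewrite sub0set.
Qed.

(** Matchings that miss [u] give the first term. The others contain exactly one edge [[set u; k]];
    removing it leaves a matching that avoids [u] and [k], and flips the sign. *)
Lemma wmatchingD1 (A : comNzRingType) (G : sgraph) (x : G -> A) (S : {set G})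
    (u : G) : u \in S ->
  wmatching x S = x u * wmatching x (S :\ u)
                - \sum_(k in S | adj u k) wmatching x (S :\ u :\ k).
Proof.
move=> uS; rewrite {1}/wmatching (bigID (fun M => u \notin cover M)) /=.
congr (_ + _).
  rewrite /wmatching big_distrr /=; apply: eq_big => [M|M /andP[/andP[_ sMS] uM]].
    by rewrite subsetD1 -!andbA.
  rewrite (bigD1 u) /= ?inE ?uM // mulrCA; congr (_ * (_ * _)).
  by apply: eq_bigl => v; rewrite !inE; case: (v == u); rewrite ?andbF ?andbT.
(* The default [u] is never returned for a matching that covers [u]. *)
pose partner (M : {set {set G}}) := odflt u [pick k | [set u; k] \in M].
rewrite (partition_big partner (fun k => (k \in S) && adj u k)) /=; last first.
  move=> M /andP[/andP[mM sMS]]; rewrite negbK => /(matching_coverP _ mM)[k uk ukM].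
  rewrite /partner; case: pickP => [l ulM|/(_ k)]; last by rewrite ukM.
  have <- := matching_edge_uniq mM ukM ulM; rewrite /= uk andbT.
  apply: (subsetP sMS); apply/bigcupP; exists [set u; k] => //.
  by rewrite !inE eqxx orbT.
rewrite -sumrN; apply: eq_bigr => k /andP[kS uk]; set e := [set u; k].
have partnerE M : is_matching M -> u \in cover M -> (partner M == k) = (e \in M).
  move=> mM /(matching_coverP _ mM)[l _ ulM]; rewrite /partner /e.
  case: pickP => [j ujM /=|/(_ l)]; last by rewrite ulM.
  apply/eqP/idP => [<- //|ukM]; exact: matching_edge_uniq mM ujM ukM.
have coverU1 (M : {set {set G}}) : cover (e |: M) = e :|: cover M.
  by rewrite /cover bigcup_setU big_set1.
have uU1 (M : {set {set G}}) : u \in cover (e |: M).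
  by rewrite coverU1 !inE eqxx.
rewrite (reindex_onto (fun M => e |: M) (fun M => M :\ e)) /=; last first.
  move=> M /andP[/andP[/andP[mM _]]]; rewrite negbK => uM.
  by rewrite partnerE // => /setD1K.
rewrite /wmatching -sumrN; apply: eq_big => [M|M].
  rewrite uU1 andbT; apply/andP/andP => [[]|[mM sM]].
    case/andP=> /andP[mU sU] _ /eqP UK.
    have eU : e \in e |: M by rewrite setU11.
    have mM : is_matching M by rewrite -UK matchingD1.
    have /andP[_ tU] := mU.
    split=> //; rewrite -UK (coverD1 tU eU) setDDl setSD //.
  have dis : [disjoint e & cover M].
    rewrite disjoint_sym; apply: disjointWl sM _.
    by rewrite setDDl -setI_eq0 setIDAC setIC -setIDAC setDv set0I.
  have /andP[mU eM] := matchingU1 uk mM dis.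
  rewrite mU partnerE // setU11 setU1K // eqxx; split=> //.
  rewrite coverU1 !subUset !sub1set uS kS /= andbT.
  by apply: subset_trans sM _; rewrite setDDl subsetDl.
case/andP=> /andP[/andP[mU sU] _] /eqP UK.
have eM : e \notin M by rewrite -UK setD11.
by rewrite cardsU1 eM add1n exprS coverU1 !setDDl /e -setUA mulN1r mulNr.
Qed.

Lemma imsetD1 (aT rT : finType) (f : aT -> rT) (S : {set aT}) (a : aT) :
  injective f -> f @: (S :\ a) = (f @: S) :\ f a.
Proof.
move=> injf; rewrite -imset_set1; apply/setP => y.
apply/imsetP/setDP => [[b /setD1P[nba bS] ->]|[/imsetP[b bS ->]]].
  rewrite imset_f //; split=> //; apply/imsetP => -[c /set1P->] /injf/eqP.
  by rewrite (negbTE nba).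
by move=> nfb; exists b; rewrite // !inE bS andbT; apply: contraNneq nfb => ->;
  rewrite imset_set1 inE.
Qed.

(** Serves both for automorphisms of a graph and for the inclusion of [del_vertex v] into it. *)
Lemma wmatching_imset (A : comNzRingType) (G H : sgraph) (f : G -> H)
    (x : H -> A) (S : {set G}) :
    injective f -> (forall a b, adj (f a) (f b) = adj a b) ->
  wmatching x (f @: S) = wmatching (x \o f) S.
Proof.
move=> injf adjf; have [n] := ubnP #|S|; elim: n S => // n IH S ltS.
have [->|[u uS]] := set_0Vmem S; first by rewrite imset0 !wmatching0.
rewrite (wmatchingD1 _ uS) (wmatchingD1 _ (imset_f f uS)) -imsetD1 //.
have lt1 : (#|S :\ u| < n)%N.
  by move: ltS; rewrite [#|S|](cardsD1 u) uS.
rewrite IH //; congr (_ - _).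
rewrite [LHS]big_mkcondr big_imset /=; last by move=> ? ? _ _ /injf.
rewrite [RHS]big_mkcondr; apply: eq_bigr => k kS; rewrite adjf.
case: ifP => // _; rewrite -imsetD1 // IH //.
by apply: leq_ltn_trans lt1; apply: subset_leq_card; apply: subD1set.
Qed.

Lemma eq_wmatching (A : comNzRingType) (G : sgraph) (x y : G -> A)
    (S : {set G}) : {in S, x =1 y} -> wmatching x S = wmatching y S.
Proof.
move=> xy; apply: eq_bigr => M _; congr (_ * _); apply: eq_bigr => v.
by case/setDP => vS _; apply: xy.
Qed.

(** In the expansion along [v] the weight of [v] occurs once, all other factors living on sets
    without [v]; hence [wmatching] is affine in each weight. *)
Lemma wmatching_shift (A : comNzRingType) (G : sgraph) (x : G -> A)
    (S : {set G}) (v : G) (l : A) :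
  v \in S -> wmatching (fun w => x w + l *+ (w == v)) S =
             wmatching x S + l * wmatching x (S :\ v).
Proof.
move=> vS; rewrite !(wmatchingD1 _ vS) eqxx mulr1n.
have E (T : {set G}) : v \notin T ->
    wmatching (fun w => x w + l *+ (w == v)) T = wmatching x T.
  move=> vT; apply: eq_wmatching => w wT.
  by rewrite (negbTE (memPn vT _ wT)) addr0.
rewrite E ?setD11 //; rewrite mulrDl addrAC; congr (_ - _ + _).
by apply: eq_bigr => k _; rewrite E // !inE eqxx andbF.
Qed.

(* Expanding along u, the right-hand side equals mu(S \ u \ v)^2 [u ~ v] plus
   the sum over k ~ u, k != v, of the right-hand sides for (S \ u, k, v). *)
Lemma wmatching_heilmann_lieb (R : realDomainType) (G : sgraph) (x : G -> R)
    (S : {set G}) (u v : G) : u \in S -> v \in S -> u != v ->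
  wmatching x (S :\ u :\ v) ^+ 2 *+ adj u v <=
  wmatching x (S :\ u) * wmatching x (S :\ v)
    - wmatching x S * wmatching x (S :\ u :\ v).
Proof.
have [n] := ubnP #|S|; elim: n S u v => // n IH S u v ltS uS vS nuv.
have uSv : u \in S :\ v by rewrite !inE nuv.
have Svu : S :\ v :\ u = S :\ u :\ v by rewrite !setDDl setUC.
have sumE (F : G -> R) : \sum_(k in S | adj u k) F k =
    F v *+ adj u v + \sum_(k in S :\ v | adj u k) F k.
  rewrite (big_setIDcond _ S [set v]) (setIidPr _) ?sub1set //=; congr (_ + _).
  by rewrite big_mkcondr big_set1; case: adj.
rewrite (wmatchingD1 _ uS) (wmatchingD1 _ uSv) Svu sumE.
set t := \sum_(k in S :\ v | _) _; set s := \sum_(k in S :\ v | _) _.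
rewrite -subr_ge0 /=.
have -> : wmatching x (S :\ u) * (x u * wmatching x (S :\ u :\ v) - t) -
   (x u * wmatching x (S :\ u) - (wmatching x (S :\ u :\ v) *+ adj u v + s)) *
   wmatching x (S :\ u :\ v) - wmatching x (S :\ u :\ v) ^+ 2 *+ adj u v =
   s * wmatching x (S :\ u :\ v) - wmatching x (S :\ u) * t.
  by case: (adj u v) => /=; rewrite ?mulr1n ?mulr0n; ring.
rewrite big_distrl big_distrr -sumrB /=; apply: sumr_ge0 => k.
case/andP => /setD1P[nkv kS] uk; have nuk := adj_neq uk.
have -> : S :\ u :\ v :\ k = S :\ u :\ k :\ v by rewrite !setDDl (setUC [set k]).
have := IH (S :\ u) k v; rewrite nkv !inE (eq_sym k) nuk (eq_sym v) nuv kS vS.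
have lt1 : (#|S :\ u| < n)%N.
  by move: ltS; rewrite [#|S|](cardsD1 u) uS.
move=> /(_ lt1 isT isT isT); apply: le_trans.
by rewrite mulrn_wge0 // sqr_ge0.
Qed.

(** * The univariate matching polynomial and its derivative *)

Definition smatching (R : comNzRingType) (G : sgraph) (S : {set G}) : {poly R} :=
  wmatching (fun=> 'X) S.

Lemma horner_smatching (R : comNzRingType) (G : sgraph) (S : {set G}) (a : R) :
  (smatching R S).[a] = wmatching (fun=> a) S.
Proof.
rewrite horner_sum; apply: eq_bigr => M _.
rewrite hornerM horner_prod -[(-1) ^+ _](rmorph_sign polyC) hornerC.
by congr (_ * _); apply: eq_bigr => v _; rewrite hornerX.
Qed.

Lemma smatching0 (R : comNzRingType) (G : sgraph) :
  smatching R (set0 : {set G}) = 1.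
Proof. exact: wmatching0. Qed.

(** The exponent of the monomial of [M] counts the vertices of [S] that [M] misses, and [M] misses
    [v] exactly when it is a matching of [S :\ v]. *)
Lemma deriv_smatching (R : comNzRingType) (G : sgraph) (S : {set G}) :
  (smatching R S)^`() = \sum_(v in S) smatching R (S :\ v).
Proof.
rewrite /smatching /wmatching [RHS](exchange_big_dep
  (fun M : {set {set G}} => is_matching M && (cover M \subset S))) /=; last first.
  by move=> v M _ /andP[-> /subset_trans->] //; apply: subD1set.
rewrite raddf_sum /=; apply: eq_bigr => M /andP[mM sM].
rewrite [RHS](eq_bigl (fun v => v \in S :\: cover M)); last first.
  by move=> v; rewrite mM subsetD1 sM !inE andbC.
rewrite -[(-1) ^+ _](rmorph_sign polyC) mul_polyC derivZ prodr_const derivXn -mul_polyC.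
rewrite -big_distrr /=; congr (_ * _).
rewrite -sumr_const; apply: eq_bigr => v vS.
rewrite prodr_const [in LHS](cardsD1 v) vS; congr (_ ^+ _); apply: eq_card => w.
by rewrite !inE; case: (w == v); rewrite ?andbF.
Qed.

Lemma matching_polyE (R : comNzRingType) (G : sgraph) :
  matching_poly R G = smatching R [set: G].
Proof.
have cardM (M : {set {set G}}) : is_matching M -> (#|M| <= #|G|./2)%N.
  by move=> mM; rewrite -[#|M|]doubleK -matching_cover_card // half_leq ?max_card.
rewrite /smatching /wmatching.
(* Matchings are grouped by size; [cardM] ensures that [inord] keeps the size. *)
rewrite (partition_big (fun M : {set {set G}} => inord #|M| : 'I_(#|G|./2).+1) predT) //=.
apply: eq_bigr => r _.
rewrite /num_matchings -sum1_card natr_sum big_distrr scaler_suml /=.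
apply: eq_big => [M|M]; rewrite inE.
  rewrite subsetT andbT; case mM: (is_matching M) => //=.
  by rewrite -(inj_eq val_inj) /= inordK // ltnS cardM.
case/andP=> mM /eqP cM; rewrite mulr1 prodr_const -cM setTD cardsCs setCK.
by rewrite matching_cover_card // cM -mul_polyC rmorph_sign.
Qed.

Lemma matching_poly_del_vertex (R : comNzRingType) (G : sgraph) (v : G) :
  matching_poly R (del_vertex v) = smatching R ([set: G] :\ v).
Proof.
have <- : (val : del_vertex v -> G) @: setT = setT :\ v.
  apply/setP => w; rewrite !inE andbT; apply/imsetP/idP => [[x _ ->]|wv].
    exact: (valP x).
  by exists (Sub w wv).
by rewrite matching_polyE /smatching wmatching_imset //; apply: val_inj.
Qed.

(** * Polynomial inequalities and root multiplicity over a real closed field *)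

Lemma horner_ge0_closure (R : rcfType) (p : {poly R}) (t : R) :
  (forall a, a != t -> 0 <= p.[a]) -> 0 <= p.[t].
Proof.
move=> p_ge0; rewrite leNgt; apply/negP => pt_lt0.
(* By continuity a negative value at [t] would persist at [t + d / 2]. *)
have [|d d_gt0 /(_ (t + d / 2))] := @poly_cont _ t p (- p.[t]).
  by rewrite oppr_gt0.
have d2 : 0 < d / 2 by rewrite divr_gt0.
rewrite addrC addKr gtr0_norm // ltr_pdivrMr // ltr_pMr // ltr1n => /(_ isT).
apply/negP; rewrite -leNgt (le_trans _ (ler_norm _)) // lerDr.
by apply: p_ge0; rewrite addrC -subr_eq0 addrK gt_eqF.
Qed.

Lemma horner_ge0_cofactor (R : rcfType) (p : {poly R}) (t : R) (k : nat) :
  (forall a, 0 <= (p * ('X - t%:P) ^+ k.*2).[a]) -> 0 <= p.[t].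
Proof.
move=> p_ge0; apply: horner_ge0_closure => a nat.
have := p_ge0 a; rewrite hornerM horner_exp hornerXsubC pmulr_lge0 //.
by rewrite -muln2 exprM exprn_even_gt0 //= expf_neq0 // subr_eq0.
Qed.

Section RootMultiplicity.
Variables (R : rcfType) (t : R).
Implicit Types p q r : {poly R}.
Local Notation L := ('X - t%:P).

(** Dividing the inequality by [L ^+ j.*2] and letting the point tend to [t], the right side
    vanishes thanks to its extra factor [L], so [q / L ^+ j] vanishes at [t] too. *)
Lemma dvdp_sqr_le q r j : (forall a, q.[a] ^+ 2 <= r.[a]) ->
  L ^+ j %| q -> L ^+ j.*2.+1 %| r -> L ^+ j.+1 %| q.
Proof.
move=> qr /dvdpP[q1 Eq] /dvdpP[r1 Er].
have : 0 <= (r1 * L - q1 ^+ 2).[t].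
  apply: (@horner_ge0_cofactor _ _ _ j) => a; have := qr a.
  rewrite -subr_ge0 -horner_exp -hornerN -hornerD; congr (0 <= _.[a]).
  by rewrite Eq Er exprMn -exprM muln2 exprS; ring.
rewrite hornerD hornerN hornerM hornerXsubC subrr mulr0 add0r oppr_ge0.
rewrite horner_exp -[_ <= 0]andbT -(sqr_ge0 q1.[t]) -eq_le sqrf_eq0.
by rewrite Eq exprS => q1t; apply: dvdp_mul; rewrite // dvdp_XsubCl.
Qed.

Lemma dvdp_deriv k p : L ^+ k.+1 %| p -> L ^+ k %| p^`().
Proof.
case/dvdpP=> q ->; rewrite derivM dvdp_add ?dvdp_mull ?dvdp_exp2l //.
by rewrite deriv_exp -mulr_natr dvdp_mulr // dvdp_mull.
Qed.

(** In characteristic 0, derivation lowers the multiplicity of a root by exactly one. *)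
Lemma root_dvdp_deriv k p : root p t -> L ^+ k %| p^`() -> L ^+ k.+1 %| p.
Proof.
elim: k => [|k IH] rp dp; first by rewrite dvdp_XsubCl.
have /dvdpP[q Ep] := IH rp (dvdp_trans (dvdp_exp2l _ (leqnSn k)) dp).
move: dp; rewrite Ep derivM deriv_exp derivXsubC mul1r -mulr_natr /=.
have -> : q * (L ^+ k * k.+1%:R) = (q * (k.+1%:R)%:P) * L ^+ k.
  by rewrite polyC_natr; ring.
rewrite dvdp_addr; last exact: dvdp_mull.
rewrite [X in X %| _ * L ^+ k]exprS.
rewrite dvdp_mul2r ?expf_neq0 ?polyXsubC_eq0 // dvdp_XsubCl rootE hornerM.
rewrite hornerC mulf_eq0 pnatr_eq0 orbF => qt.
by rewrite exprS; apply: dvdp_mul; rewrite // dvdp_XsubCl.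
Qed.

End RootMultiplicity.

(** * Root multiplicity under vertex deletion *)

Section MatchingPolynomialRoots.
Variables (R : rcfType) (G : sgraph).
Implicit Types (S : {set G}) (u v w : G).
Local Notation P := (smatching R).

Lemma smatching_heilmann_lieb S u v a : u \in S -> v \in S -> u != v ->
  (P (S :\ u :\ v)).[a] ^+ 2 *+ adj u v <=
  (P (S :\ u) * P (S :\ v) - P S * P (S :\ u :\ v)).[a].
Proof.
move=> uS vS uv; rewrite hornerD hornerN !hornerM !horner_smatching.
exact: wmatching_heilmann_lieb.
Qed.

(** With both derivatives written as sums over deleted vertices, the term of [w] is the square and
    the others are nonnegative by Heilmann-Lieb. *)
Lemma smatching_wronskian S w a : w \in S ->
  (P (S :\ w)).[a] ^+ 2 <=
  ((P S)^`() * P (S :\ w) - P S * (P (S :\ w))^`()).[a].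
Proof.
move=> wS.
have -> : (P S)^`() * P (S :\ w) - P S * (P (S :\ w))^`() = P (S :\ w) ^+ 2 +
    \sum_(v in S :\ w) (P (S :\ w) * P (S :\ v) - P S * P (S :\ w :\ v)).
  rewrite !deriv_smatching (big_setD1 w) //= mulrDl -expr2 -addrA.
  by rewrite mulrC !big_distrr sumrB.
rewrite hornerD horner_exp lerDl horner_sum sumr_ge0 // => v /setD1P[vw vS].
rewrite eq_sym in vw.
by apply: le_trans (smatching_heilmann_lieb a wS vS vw); rewrite mulrn_wge0 ?sqr_ge0.
Qed.

(** If [P S] were zero, the Wronskian bound would make every power of ['X] divide [P (S :\ w)],
    which is nonzero by induction. *)
Lemma smatching_neq0 S : P S != 0.
Proof.
have [n] := ubnP #|S|; elim: n S => // n IH S ltS.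
have [->|[w wS]] := set_0Vmem S; first by rewrite smatching0 oner_neq0.
have /IH : (#|S :\ w| < n)%N by move: ltS; rewrite [#|S|](cardsD1 w) wS.
apply: contra => /eqP PS0.
have dvdPw j : ('X - 0%:P) ^+ j %| P (S :\ w).
  elim: j => [|j IHj]; first exact: dvd1p.
  apply: dvdp_sqr_le IHj (dvdp0 _) => a.
  by have := smatching_wronskian a wS; rewrite PS0 deriv0 !mul0r subrr.
apply: contraT => Pw0; have := dvdp_leq Pw0 (dvdPw (size (P (S :\ w)))).
by rewrite size_exp_XsubC ltnn.
Qed.

Variable t : R.
Local Notation L := ('X - t%:P).

(** The half of interlacing needed here: the Wronskian bound raises the power of [L] dividing
    [P (S :\ w)] one step at a time. *)
Lemma dvdp_smatchingD1 S w k : w \in S ->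
  L ^+ k.+1 %| P S -> L ^+ k %| P (S :\ w).
Proof.
move=> wS dS.
suff dw j : (j <= k)%N -> L ^+ j %| P (S :\ w) by apply: dw.
elim: j => [|j IH] ltjk; first exact: dvd1p.
have dj := IH (ltnW ltjk); apply: dvdp_sqr_le (dj) _ => [a|].
  exact: smatching_wronskian.
apply: dvdp_sub.
  rewrite -addnn -addSn exprD dvdp_mul //.
  by rewrite (dvdp_trans (dvdp_exp2l _ ltjk)) // dvdp_deriv.
(* For positive [j] the derivative loses one factor [L], which the higher multiplicity in [P S]
   makes up for. *)
case: j ltjk dj {IH} => [|j] ltjk dj.
  by rewrite dvdp_mulr // (dvdp_trans _ dS) // dvdp_exp2l.
rewrite doubleS -addnn -!addSn exprD.
by rewrite dvdp_mul ?dvdp_deriv // (dvdp_trans _ dS) // dvdp_exp2l.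
Qed.

(** Adjacency puts the square of [P (S :\ u :\ v)] into the Heilmann-Lieb inequality, so
    [dvdp_sqr_le] applies. *)
Lemma dvdp_smatchingD2 S u v k : u \in S -> v \in S -> adj u v ->
  L ^+ k.+1 %| P S -> L ^+ k %| P (S :\ u :\ v).
Proof.
move=> uS vS uv dS; have nuv := adj_neq uv.
suff dw j : (j <= k)%N -> L ^+ j %| P (S :\ u :\ v) by apply: dw.
elim: j => [|j IH] ltjk; first exact: dvd1p.
have dj := IH (ltnW ltjk); apply: dvdp_sqr_le (dj) _ => [a|].
  by have := smatching_heilmann_lieb a uS vS nuv; rewrite uv; apply.
rewrite -addnn -addSn exprD; apply: dvdp_sub.
  apply: dvdp_mul; apply: dvdp_smatchingD1 => //;
    by apply: dvdp_trans dS; rewrite dvdp_exp2l // ltnW.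
by rewrite dvdp_mul // (dvdp_trans _ dS) // dvdp_exp2l // ltnW.
Qed.

(* Give v the weight x + s (x - t): after division by (x - t)^(2k+2), the
   Heilmann-Lieb inequality for u, w becomes at x = t an inequality
   au aw >= (c + s av) d that is affine in s with av != 0, hence d = 0. *)
Lemma dvdp_smatching_trans S u v w k : u \in S -> v \in S -> w \in S ->
    u != v -> w != v -> u != w ->
    L ^+ k.+2 %| P S -> ~~ (L ^+ k.+2 %| P (S :\ v)) ->
    L ^+ k.+1 %| P (S :\ u :\ v) -> L ^+ k.+1 %| P (S :\ w :\ v) ->
  L ^+ k.+1 %| P (S :\ u :\ w).
Proof.
move=> uS vS wS uv wv uw dS ndv duv dwv.
have dvw : L ^+ k %| P (S :\ u :\ w :\ v).
  rewrite setDDl (setUC [set w]) -setDDl.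
  by apply: dvdp_smatchingD1 duv; rewrite !inE wv (eq_sym w u) uw.
have dw : L ^+ k %| P (S :\ u :\ w).
  apply: dvdp_smatchingD1; first by rewrite !inE (eq_sym w u) uw.
  exact: dvdp_smatchingD1.
have [du dw1 dv] : [/\ L ^+ k.+1 %| P (S :\ u), L ^+ k.+1 %| P (S :\ w)
    & L ^+ k.+1 %| P (S :\ v)] by split; apply: dvdp_smatchingD1.
have /dvdpP[c Ec] := dS; have /dvdpP[au Eau] := du; have /dvdpP[aw Eaw] := dw1.
have /dvdpP[av Eav] := dv; have /dvdpP[buv Ebuv] := duv.
have /dvdpP[bwv Ebwv] := dwv; have /dvdpP[d Ed] := dw; have /dvdpP[e Ee] := dvw.
have avt : av.[t] != 0.
  apply: contra ndv; rewrite -[_ == 0]/(root av t) -dvdp_XsubCl => Lav.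
  by rewrite Eav exprS dvdp_mul.
suff /eqP dt : d.[t] == 0.
  by rewrite Ed exprS dvdp_mul // dvdp_XsubCl rootE dt.
apply: contraT => dt.
(* Chosen so that [(c + s av) d] exceeds [au aw] by 1 at [t], that is, [q.[t] = -1]. *)
pose s := ((au.[t] * aw.[t] + 1) / d.[t] - c.[t]) / av.[t].
pose q := (au + s *: L * buv) * (aw + s *: L * bwv)
          - (c + s%:P * av) * (d + s *: L * e).
have : 0 <= q.[t].
  apply: (@horner_ge0_cofactor _ _ _ k.+1) => a.
  pose x (z : G) := a + (s * (a - t)) *+ (z == v).
  have := @wmatching_heilmann_lieb _ G x S u w uS wS uw.
  rewrite eq_sym in uv; rewrite eq_sym in wv.
  rewrite /x !wmatching_shift ?inE ?uv ?wv ?vS //.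
  rewrite -!horner_smatching Ec Eau Eaw Eav Ebuv Ebwv Ed Ee => HL.
  have := le_trans (mulrn_wge0 _ (sqr_ge0 _)) HL; congr (0 <= _).
  rewrite /q -mul_polyC -muln2 !exprS exprM.
  rewrite !(hornerD, hornerN, hornerM, hornerC, hornerX, horner_exp).
  by ring.
rewrite /q !(hornerD, hornerN, hornerM, hornerZ, hornerC, hornerX) subrr.
rewrite !(mulr0, mul0r, addr0) /s.
have -> : au.[t] * aw.[t] - (c.[t] + ((au.[t] * aw.[t] + 1) / d.[t] - c.[t])
    / av.[t] * av.[t]) * d.[t] = -1.
  by field; rewrite avt dt.
by rewrite oppr_ge0 ler10.
Qed.

End MatchingPolynomialRoots.

(** * Connected vertex-transitive graphs *)

Theorem theorem2p8 (R : realType) (G : sgraph) (z : G) (theta : R) :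
  connected_graph G -> vertex_transitive G ->
  root (matching_poly R (del_vertex z)) theta ->
  super_positive theta G.
Proof.
move=> [_ conG] vtG; rewrite matching_poly_del_vertex => rz.
pose P := @smatching R G; pose T := [set: G].
have Pv v : P (T :\ v) = P (T :\ z).
  have [s autG <-] := vtG z v.
  have -> : T :\ s z = s @: (T :\ z).
    rewrite imsetD1; last exact: perm_inj.
    congr (_ :\ _); apply/setP => y; rewrite !inE; apply/esym/imsetP.
    by exists (s^-1%g y); rewrite ?inE ?permKV.
  rewrite /P /smatching wmatching_imset //; exact: perm_inj.
split=> [|v]; last first.
  by rewrite matching_poly_del_vertex -/T -/(P _) Pv; apply/eqP.
rewrite matching_polyE -/T; apply/negP; rewrite -[_ == 0]/(root _ theta) => rT.
pose L := 'X - theta%:P.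
have P'T : (P T)^`() = P (T :\ z) *+ #|G|.
  rewrite deriv_smatching (eq_bigr (fun=> P (T :\ z))) // sumr_const.
  by rewrite cardsT.
have P'z k : (L ^+ k %| (P T)^`()) = (L ^+ k %| P (T :\ z)).
  rewrite P'T -scaler_nat dvdpZr // pnatr_eq0 -lt0n.
  by apply/card_gt0P; exists z.
have [m [q]] := multiplicity_XsubC (P T) theta.
rewrite smatching_neq0 -/L /= => nq Eq.
have dT : L ^+ m %| P T by rewrite Eq dvdp_mull.
(* Otherwise [L ^+ m] would divide the derivative of [P T], and [theta] would have multiplicity
   above [m] in [P T]. *)
have ndz : ~~ (L ^+ m %| P (T :\ z)).
  apply: contra nq; rewrite -P'z => /(root_dvdp_deriv rT).
  by rewrite -/L -/(P T) Eq exprS dvdp_mul2r ?expf_neq0 ?polyXsubC_eq0 // dvdp_XsubCl.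
case: m => [|[|k]] in Eq dT ndz.
- by rewrite dvd1p in ndz.
- by rewrite expr1 dvdp_XsubCl rz in ndz.
(* Parallelism is transitive through any [y]: by [Pv], the non-divisibility [ndz] holds at [y] as
   well. *)
have step x y w : x != y -> w != y -> x != w -> L ^+ k.+1 %| P (T :\ x :\ y) ->
    L ^+ k.+1 %| P (T :\ w :\ y) -> L ^+ k.+1 %| P (T :\ x :\ w).
  move=> xy wy xw dxy dwy.
  by apply: dvdp_smatching_trans dT _ dxy dwy; rewrite ?inE // -/L -/(P _) Pv.
have dpath x y : x != y -> L ^+ k.+1 %| P (T :\ x :\ y).
  move=> nxy; have /connectP[p] := conG x y; elim: p => [|w p IH] /= in x nxy *.
    by move=> _ xy; rewrite xy eqxx in nxy.
  case/andP=> xw pw Ey.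
  have dxw : L ^+ k.+1 %| P (T :\ x :\ w).
    by apply: dvdp_smatchingD2 dT; rewrite ?inE.
  have [<- //|nwy] := eqVneq w y.
  (* The middle vertex is [w], the successor of [x] on the path: adjacent to [x], and parallel to
     [y] by induction. *)
  apply: (step x w y) => //; first exact: adj_neq.
    by rewrite eq_sym.
  by rewrite setDDl setUC -setDDl IH.
suff : L ^+ k.+2 %| P (T :\ z) by apply/negP.
apply: root_dvdp_deriv => //; rewrite deriv_smatching.
apply: (big_ind (fun p => L ^+ k.+1 %| p)) => [|p1 p2 d1 d2|v /setD1P[vz _]].
- exact: dvdp0.
- exact: dvdp_add.
by apply: dpath; rewrite eq_sym.
Qed.
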